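(* For every integer $n \ge 2$, in the edge-distinguishing game (EDGe) played on the complete graph $K_n$ (with $\lambda(K_n)$ colors), Player 2 has a winning strategy.
   Context: All graphs are finite and simple. For a positive integer $k$ let $[k]=\{1,\dots,k\}$. A $k$-coloring of a graph $G$ is a map $c:V(G)\to[k]$; it induces the edge coloring $c'(\{u,v\})=\{c(u),c(v)\}$, a 2-element multiset of colors. The coloring $c$ is edge-distinguishing if $c'$ is injective, and the edge-distinguishing chromatic number $\lambda(G)$ is the least $k$ for which an edge-distinguishing $k$-coloring of $G$ exists. A partial coloring is a map $c:U\to[k]$ with $U\subseteq V(G)$; its partial induced edge coloring is the induced edge coloring on the induced subgraph $G[U]$ (edges with both endpoints colored). EDGe on $G$: two players, Player 1 moving first, alternately choose an uncolored vertex and give it a color from $[\lambda(G)]$; a move is legal iff after it the partial induced edge coloring of the colored vertices is injective. The player making the last legal move wins (a player with no legal move loses). A player has a winning strategy if they can guarantee a win regardless of the opponent's moves. *)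

(* Defs.v *)
From mathcomp Require Import all_boot finmap multiset.

Set Implicit Arguments.
Unset Strict Implicit.
Unset Printing Implicit Defensive.

Record sgraph := SGraph {
  vertex :> finType;
  adj : rel vertex;
  adj_sym : symmetric adj;
  adj_irrefl : irreflexive adj
}.

Definition edges (G : sgraph) : {set {set G}} :=
  [set [set p.1; p.2] | p : G * G & adj p.1 p.2].

(* The color set [k] = {1, ..., k} is represented by 'I_k. *)
Section Colorings.

Variables (G : sgraph) (k : nat).

Definition edge_color (c : {ffun G -> 'I_k}) (e : {set G}) : {mset 'I_k}%mset :=
  seq_mset [seq c x | x <- enum e].

Definition edge_distinguishing (c : {ffun G -> 'I_k}) : bool :=
  dinjectiveb (edge_color c) (edges G).

(* Uncolored vertices are sent to None. *)
Definition partial_coloring := {ffun G -> option 'I_k}.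

Definition colored (c : partial_coloring) : {set G} := [set x | c x != None].

(* Only used on sets e of colored vertices, where pmap drops nothing. *)
Definition partial_edge_color (c : partial_coloring) (e : {set G}) :
    {mset 'I_k}%mset :=
  seq_mset (pmap c (enum e)).

Definition edges_in (U : {set G}) : {set {set G}} :=
  [set e in edges G | e \subset U].

Definition partial_edge_distinguishing (c : partial_coloring) : Prop :=
  {in edges_in (colored c) &, injective (partial_edge_color c)}.

End Colorings.

Lemma edge_distinguishing_exists (G : sgraph) :
  exists k, (0 < k) && [exists c : {ffun G -> 'I_k}, edge_distinguishing c].
Proof.
exists #|G|.+1; rewrite ltn0Sn; apply/existsP.
pose c := [ffun x : G => lift ord0 (enum_rank x)].
have c_inj : injective c.
  by move=> x y; rewrite !ffunE => /lift_inj /enum_rank_inj.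
exists c; apply/dinjectiveP => e f _ _ /eq_seq_msetP /perm_mem ef.
by apply/setP => x; have := ef (c x); rewrite !mem_map // !mem_enum.
Qed.

Definition edcn (G : sgraph) : nat := ex_minn (edge_distinguishing_exists G).

Inductive player := Player1 | Player2.

Section Game.

Variable G : sgraph.

Notation k := (edcn G).

Definition position := partial_coloring G k.

Definition move : Type := (G * 'I_k)%type.

Definition play_move (c : position) (m : move) : position :=
  [ffun x => if x == m.1 then Some m.2 else c x].

Definition legal (c : position) (m : move) : Prop :=
  c m.1 = None /\ partial_edge_distinguishing (play_move c m).

(* A play is recorded as the list of the moves made so far, oldest first. *)
Definition position_after (h : seq move) : position :=
  foldl play_move [ffun=> None] h.

Inductive legal_play : seq move -> Prop :=
| legal_play_nil : legal_play [::]
| legal_play_rcons h m :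
    legal_play h -> legal (position_after h) m -> legal_play (rcons h m).

Definition to_move (h : seq move) : player :=
  if odd (size h) then Player2 else Player1.

Definition finished (h : seq move) : Prop :=
  forall m, ~ legal (position_after h) m.

Definition strategy := seq move -> option move.

(* A strategy may not resign: whenever it is p's turn and p has a legal move,
   it prescribes one. *)
Definition strategy_for (p : player) (s : strategy) : Prop :=
  forall h, legal_play h -> to_move h = p -> ~ finished h ->
  exists2 m, s h = Some m & legal (position_after h) m.

Definition follows (p : player) (s : strategy) (h : seq move) : Prop :=
  forall h' m, prefix (rcons h' m) h -> to_move h' = p -> s h' = Some m.

(* In a finished play the player to move loses. *)
Definition winning_strategy (p : player) (s : strategy) : Prop :=
  strategy_for p s /\
  forall h, legal_play h -> follows p s h -> finished h -> to_move h <> p.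

Definition has_winning_strategy (p : player) : Prop :=
  exists s, winning_strategy p s.

End Game.

Lemma complete_adj_sym n : symmetric (fun x y : 'I_n => x != y).
Proof. by move=> x y; rewrite eq_sym. Qed.

Lemma complete_adj_irrefl n : irreflexive (fun x y : 'I_n => x != y).
Proof. by move=> x; rewrite eqxx. Qed.

Definition complete_graph (n : nat) : sgraph :=
  SGraph (@complete_adj_sym n) (@complete_adj_irrefl n).

(* Main.v *)
Require Import Defs.
From mathcomp Require Import all_boot finmap multiset.

Set Implicit Arguments.
Unset Strict Implicit.
Unset Printing Implicit Defensive.

(** Player 2 answers the first move [(x, a)] by giving the same color [a] to
    another vertex [y]. From then on no vertex [z] can be colored: the edges
    [xz] and [yz] would receive the same color. So the play ends after exactly
    two moves, and the value of the edge-distinguishing chromatic number plays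
    no role. *)

Lemma legal_play_prefix (G : sgraph) (h1 h2 : seq (move G)) :
  legal_play (h1 ++ h2) -> legal_play h1.
Proof.
elim/last_ind: h2 => [|h2 m IH]; first by rewrite cats0.
rewrite -rcons_cat => Hp; apply: IH.
case E: _ / Hp => [|h m' Hh _]; first by case: (h1 ++ h2) E.
by case/rcons_inj: E => ->.
Qed.

Lemma legal_play_last (G : sgraph) (h : seq (move G)) m :
  legal_play (rcons h m) -> legal (position_after h) m.
Proof.
move=> Hp; case E: _ / Hp => [|h' m' _ Hm]; first by case: h E.
by case/rcons_inj: E => -> ->.
Qed.

(** A boolean form of [legal], so that [copy_strategy] can search for a legal move with [pick]. *)
Definition legalb (G : sgraph) (c : position G) (m : move G) : bool :=
  (c m.1 == None) &&
  dinjectiveb (partial_edge_color (play_move c m))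
              (edges_in (colored (play_move c m))).

Lemma legalP (G : sgraph) (c : position G) m : reflect (legal c m) (legalb c m).
Proof.
apply: (iffP andP) => [[/eqP cN /dinjectiveP inj]|[cN inj]]; split=> //.
  exact/eqP.
exact/dinjectiveP.
Qed.

Lemma card_edge (G : sgraph) (e : {set G}) : e \in edges G -> #|e| = 2.
Proof.
case/imsetP=> -[x y]; rewrite inE /= => xy ->; rewrite cards2.
by case: eqVneq xy => // ->; rewrite adj_irrefl.
Qed.

Lemma edges_in_complete n (U : {set complete_graph n})
    (x y : complete_graph n) :
  x != y -> x \in U -> y \in U -> [set x; y] \in edges_in U.
Proof.
move=> xy xU yU; rewrite inE subUset !sub1set xU yU !andbT.
by apply/imsetP; exists (x, y); rewrite ?inE.
Qed.

(** An edge has two vertices, so an edge inside [colored c] must be all of [colored c]: there is at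
    most one such edge. This makes the copying reply legal. *)
Lemma partial_edge_distinguishing_small (G : sgraph) k
    (c : partial_coloring G k) :
  #|colored c| <= 2 -> partial_edge_distinguishing c.
Proof.
move=> cle e f; rewrite !inE => /andP[eE eS] /andP[fE fS] _.
have full g : g \in edges G -> g \subset colored c -> g = colored c.
  by move=> gE gS; apply/eqP; rewrite eqEcard gS (card_edge gE).
by rewrite (full e) // (full f).
Qed.

(** [enum] may list the two vertices in either order; the multiset forgets it. *)
Lemma partial_edge_color2 (G : sgraph) k (c : partial_coloring G k) x y :
  x != y -> partial_edge_color c [set x; y] = seq_mset (pmap c [:: x; y]).
Proof.
move=> xy; apply/eq_seq_msetP/perm_pmap/uniq_perm.
- exact: enum_uniq.
- by rewrite /= inE xy.
- by move=> z; rewrite mem_enum !inE.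
Qed.

Lemma same_color_blocks n k (c : partial_coloring (complete_graph n) k)
    (x y z : complete_graph n) :
  partial_edge_distinguishing c -> x != y -> z != x -> z != y ->
  c x != None -> c x = c y -> c z = None.
Proof.
move=> inj xy zx zy cx cxy; apply/eqP/negP => /negP cz.
(* If [z] is colored, both edges get the multiset of [c z] and [c x], so injectivity identifies
   them; as [x != y], this forces [x = z]. *)
have eqe : [set z; x] = [set z; y].
  apply: inj; rewrite ?edges_in_complete ?inE -?cxy //.
  by rewrite !partial_edge_color2 //= cxy.
have := set22 z x; rewrite eqe !inE (negPf xy) orbF => /eqP xz.
by rewrite xz eqxx in zx.
Qed.

(** The last branch serves [strategy_for], which also demands answers in legal plays that deviate
    from the strategy. *)
Definition copy_strategy (G : sgraph) : strategy G := fun h =>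
  if h is [:: m] then
    if [pick y | y != m.1] is Some y then Some (y, m.2) else None
  else [pick m | legalb (position_after h) m].

Lemma card_colored_two_moves (G : sgraph) (m1 m2 : move G) :
  #|colored (position_after [:: m1; m2])| <= 2.
Proof.
apply: (@leq_trans #|[set m1.1; m2.1]|); last by rewrite cards2; case: (_ == _).
apply/subset_leq_card/subsetP => x; rewrite !inE !ffunE.
by case: (x == m1.1); case: (x == m2.1).
Qed.

Lemma copy_strategy_second n (m : move (complete_graph n)) :
  2 <= n -> exists y : complete_graph n,
  [/\ copy_strategy [:: m] = Some (y, m.2), y != m.1
    & legal (position_after [:: m]) (y, m.2)].
Proof.
move=> n2; rewrite /copy_strategy; case: pickP => [y ym|all_m].
  exists y; split=> //; split; first by rewrite !ffunE (negPf ym).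
  exact/partial_edge_distinguishing_small/(card_colored_two_moves m (y, m.2)).
(* With no vertex other than [m.1], the graph would have at most one vertex, against [2 <= n]. *)
have : #|complete_graph n| <= #|[set m.1]|.
  apply/subset_leq_card/subsetP => y _; rewrite inE.
  by have /negbFE := all_m y.
by rewrite cards1 card_ord leqNgt n2.
Qed.

Theorem theorem3p2 (n : nat) (hn : 2 <= n) :
  has_winning_strategy (complete_graph n) Player2.
Proof.
exists (@copy_strategy _); split=> [h _ _ nfin|].
  have [[m ->]|not1] : (exists m, h = [:: m]) \/ size h != 1.
  - by case: h {nfin} => [|m [|? ?]]; [right|left; exists m|right].
  - by have [y [-> _ Hl]] := copy_strategy_second m hn; exists (y, m.2).
  have -> : copy_strategy h = [pick m | legalb (position_after h) m].
    by case: h not1 {nfin} => [|? []].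
  case: pickP => [m /legalP Hm|none]; first by exists m.
  by case: nfin => m /legalP; rewrite none.
(* After zero or two moves Player 1 is to move. A one-move play is not finished, and a play of three
   or more moves that follows the strategy cannot be legal. *)
case=> [|m1 [|m2 [|m3 h]]] //.
  move=> _ _ fin; have [y [_ _ Hl]] := copy_strategy_second m1 hn.
  by case: (fin _ Hl).
move=> Hp Hf _ _.
have [y [Hs ym _]] := copy_strategy_second m1 hn.
have : Some (y, m1.2) = Some m2.
  by rewrite -Hs; apply: Hf => //; apply: (prefix_prefix [:: m1; m2] (m3 :: h)).
case=> m2E; subst m2.
(* Cutting the play after [m3] shows that [m3] was legal: its vertex differs from [m1.1] and [y],
   yet [same_color_blocks] leaves it uncolored after [m3] is played. *)
have [] := legal_play_last
  (@legal_play_prefix _ (rcons [:: m1; (y, m1.2)] m3) h Hp).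
rewrite !ffunE /=; case: (eqVneq m3.1 y) => // m3y.
case: (eqVneq m3.1 m1.1) => // m3m1 _ inj.
have m1y : m1.1 != y by rewrite eq_sym.
have := same_color_blocks inj m1y m3m1 m3y.
rewrite !ffunE /= !eqxx ![m1.1 == _]eq_sym (negPf m3m1) (negPf ym).
by rewrite (eq_sym y m3.1) (negPf m3y) => /(_ isT erefl).
Qed.
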